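(* Let $f\in C(I,I)$. The following are equivalent: (1) $f$ is strongly mixing; (2) $\mathcal C(\mathcal U)>2$ for every open cover $\mathcal U$ of $I$ consisting of two non-dense open sets; (3) $f$ has uniformly positive entropy; (4) $f$ is topological K.
   Context: $I=[0,1]$, $C(I,I)$ continuous self-maps of $I$. $f$ is strongly mixing if for all nonempty open $U,V\subset I$ there is $N$ with $f^nU\cap V\ne\emptyset$ for all $n\ge N$. For a finite open cover $\mathcal U$, $N(\mathcal U)$ is the minimal cardinality of a subcover, $\mathcal U\vee\mathcal V=\{U\cap V\}$, and $\mathcal C(\mathcal U)=\lim_{n\to\infty}N(\bigvee_{i=0}^{n-1}f^{-i}\mathcal U)$. For $A_1,\dots,A_k\subset I$, $J\subset\mathbb Z_+$ is an independence set if $\bigcap_{i\in F}f^{-i}A_{s(i)}\ne\emptyset$ for all nonempty finite $F\subset J$ and $s\in\{1,\dots,k\}^F$. A tuple $\langle x_1,\dots,x_k\rangle$ is an IE-tuple if for all neighborhoods $U_j\ni x_j$, $(U_1,\dots,U_k)$ has an independence set of positive density. $f$ has uniformly positive entropy if every pair $\langle x_1,x_2\rangle$ with $x_1\ne x_2$ is an IE-tuple, and is topological K if for every $k\ge2$ every $k$-tuple with pairwise distinct entries is an IE-tuple. *)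

(* Defs.v *)
From Stdlib Require Import Reals Lra List.
Import ListNotations.
Open Scope R_scope.

Definition inI (x : R) : Prop := 0 <= x <= 1.

(** f : R -> R represents an element of C(I,I): it maps I into I and is
    continuous on I (w.r.t. the relative topology of I). Values outside I
    are irrelevant. *)
Definition maps_I (f : R -> R) : Prop := forall x, inI x -> inI (f x).

Definition continuous_on_I (f : R -> R) : Prop :=
  forall x, inI x -> forall eps, eps > 0 ->
    exists delta, delta > 0 /\
      forall y, inI y -> Rabs (y - x) < delta -> Rabs (f y - f x) < eps.

Definition iterf (f : R -> R) (n : nat) (x : R) : R := Nat.iter n f x.

Definition open_in_I (U : R -> Prop) : Prop :=
  (forall x, U x -> inI x) /\
  (forall x, U x -> exists delta, delta > 0 /\
      forall y, inI y -> Rabs (y - x) < delta -> U y).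

Definition nonempty_in_I (U : R -> Prop) : Prop := exists x, inI x /\ U x.

Definition dense_in_I (U : R -> Prop) : Prop :=
  forall x, inI x -> forall eps, eps > 0 ->
    exists y, inI y /\ Rabs (y - x) < eps /\ U y.

Definition nbhd_in_I (U : R -> Prop) (x : R) : Prop :=
  exists eps, eps > 0 /\ forall y, inI y -> Rabs (y - x) < eps -> U y.

Definition strongly_mixing (f : R -> R) : Prop :=
  forall U V, open_in_I U -> open_in_I V -> nonempty_in_I U -> nonempty_in_I V ->
    exists N : nat, forall n : nat, (N <= n)%nat ->
      exists x, inI x /\ U x /\ V (iterf f n x).

Definition covers_I (L : list (R -> Prop)) : Prop :=
  forall x, inI x -> exists A, In A L /\ A x.

Definition min_subcover_card (L : list (R -> Prop)) (k : nat) : Prop :=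
  (exists S, incl S L /\ covers_I S /\ length S = k) /\
  (forall S, incl S L -> covers_I S -> (k <= length S)%nat).

Definition preimg (f : R -> R) (i : nat) (A : R -> Prop) : R -> Prop :=
  fun x => inI x /\ A (iterf f i x).

Fixpoint join_iter (f : R -> R) (U : list (R -> Prop)) (n : nat)
  : list (R -> Prop) :=
  match n with
  | O => [inI]
  | S m => flat_map (fun A => map (fun B => fun x => A x /\ preimg f m B x) U)
                    (join_iter f U m)
  end.

(** C(U) > 2 where C(U) = lim_n N(join_iter f U n); the sequence of
    naturals N(...) is nondecreasing, so its limit (in N ∪ {∞}) exceeds 2
    iff N(...) > 2 for all large n. *)
Definition complexity_gt2 (f : R -> R) (U : list (R -> Prop)) : Prop :=
  exists n0 : nat, forall n : nat, (n0 <= n)%nat ->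
    forall k, min_subcover_card (join_iter f U n) k -> (2 < k)%nat.

Definition two_set_cover_condition (f : R -> R) : Prop :=
  forall U1 U2 : R -> Prop,
    open_in_I U1 -> open_in_I U2 ->
    covers_I [U1; U2] ->
    ~ dense_in_I U1 -> ~ dense_in_I U2 ->
    complexity_gt2 f [U1; U2].

(** Independence sets. Subsets J of Z_+ = {0,1,2,...} are encoded as boolean
    predicates; A : nat -> (R -> Prop) lists A_0, ..., A_{k-1}. *)
Definition independence_set (f : R -> R) (k : nat) (A : nat -> R -> Prop)
  (J : nat -> bool) : Prop :=
  forall (F : list nat) (s : nat -> nat),
    F <> [] -> (forall i, In i F -> J i = true) ->
    (forall i, In i F -> (s i < k)%nat) ->
    exists x, inI x /\ forall i, In i F -> A (s i) (iterf f i x).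

Fixpoint count_below (J : nat -> bool) (n : nat) : nat :=
  match n with
  | O => O
  | S m => (if J m then 1 else 0) + count_below J m
  end.

Definition positive_density (J : nat -> bool) : Prop :=
  exists d, d > 0 /\
    Un_cv (fun n => INR (count_below J (S n)) / INR (S n)) d.

Definition IE_tuple (f : R -> R) (xs : list R) : Prop :=
  (forall x, In x xs -> inI x) /\
  forall Us : nat -> R -> Prop,
    (forall j, (j < length xs)%nat -> nbhd_in_I (Us j) (nth j xs 0)) ->
    exists J, independence_set f (length xs) Us J /\ positive_density J.

Definition uniformly_positive_entropy (f : R -> R) : Prop :=
  forall x1 x2, inI x1 -> inI x2 -> x1 <> x2 -> IE_tuple f [x1; x2].

Definition topological_K (f : R -> R) : Prop :=
  forall k : nat, (2 <= k)%nat ->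
  forall xs : list R, length xs = k -> (forall x, In x xs -> inI x) ->
    NoDup xs -> IE_tuple f xs.

(* Main.v *)
(** The cycle is (1) => (4) => (3) => (2) => (1).

    (1) => (4): by the intermediate value theorem a mixing f satisfies
    f^n [a,b] ⊇ [eta, 1-eta] for all large n, so small intervals near the x_j
    form a horseshoe for some f^N, and N Z_+ is an independence set.

    (3) => (2): two independent times already separate four points.

    (2) => (1): if O1, O2 are disjoint and open, (2) forbids every pair of
    complementary words whose avoiding sets cover I. Constant words give
    transitivity. Let c be a fixed point in (0,1). Alternating words give a
    point p in (0,1) with p and f p strictly on the same side of c. By
    transitivity the interval X between c and p is covered by its image after
    e and after e+1 steps for some e, hence after all large numbers of steps.
    Every open set is eventually mapped over c, hence over X, and X is mapped
    over any given inner point at all large times. *)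
Require Import Defs.
From Stdlib Require Import Reals List Lra Lia PeanoNat Wf_nat Classical.
Import ListNotations.
Open Scope R_scope.

(** * Iterates, open subsets of I and intermediate values *)

(** The endpoints come in either order, so later arguments need not say on which side of a fixed
    point an interval lies. *)
Definition hull (x y z : R) : Prop := Rmin x y <= z <= Rmax x y.

Ltac hull_lra :=
  unfold hull, inI, Rmin, Rmax in *; repeat destruct Rle_dec; lra.

Lemma iterf_add f n m x : iterf f (n + m) x = iterf f n (iterf f m x).
Proof. induction n as [|n IH]; [reflexivity|]. simpl. now rewrite IH. Qed.

Lemma iterf_inI f n x : maps_I f -> inI x -> inI (iterf f n x).
Proof. intros hm hx. induction n as [|n IH]; [exact hx|]. exact (hm _ IH). Qed.

Lemma iterf_fixed f n c : f c = c -> iterf f n c = c.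
Proof.
  intros hc. induction n as [|n IH]; [reflexivity|]. simpl. now rewrite IH.
Qed.

Lemma iterf_continuous f n :
  maps_I f -> continuous_on_I f -> continuous_on_I (iterf f n).
Proof.
  intros hm hc. induction n as [|n IH]; intros x hx e he.
  - exists e. split; [exact he|]. intros y _ h. exact h.
  - destruct (hc _ (iterf_inI f n x hm hx) e he) as [d [hd h]].
    destruct (IH x hx d hd) as [d' [hd' h']].
    exists d'. split; [exact hd'|]. intros y hy hxy.
    apply h; [now apply iterf_inI|]. now apply h'.
Qed.

Lemma preimg_open f n V :
  maps_I f -> continuous_on_I f -> open_in_I V -> open_in_I (preimg f n V).
Proof.
  intros hm hc [hV1 hV2]. split.
  - intros x [hx _]. exact hx.
  - intros x [hx hv]. destruct (hV2 _ hv) as [e [he h]].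
    destruct (iterf_continuous f n hm hc x hx e he) as [d [hd h']].
    exists d. split; [exact hd|]. intros y hy hxy. split; [exact hy|].
    apply h; [now apply iterf_inI|]. now apply h'.
Qed.

Lemma inter_open U V :
  open_in_I U -> open_in_I V -> open_in_I (fun x => U x /\ V x).
Proof.
  intros [hU1 hU2] [hV1 hV2]. split.
  - intros x [hx _]. now apply hU1.
  - intros x [hu hv]. destruct (hU2 _ hu) as [d [hd h]].
    destruct (hV2 _ hv) as [d' [hd' h']].
    exists (Rmin d d'). split; [hull_lra|]. intros y hy hxy.
    split; [apply h|apply h']; try assumption; hull_lra.
Qed.

Lemma lt_open a : open_in_I (fun x => inI x /\ x < a).
Proof.
  split; [now intros x [hx _]|]. intros x [hx ha]. exists (a - x). split; [lra|].
  intros y hy h. apply Rabs_def2 in h. split; [exact hy|lra].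
Qed.

Lemma gt_open a : open_in_I (fun x => inI x /\ a < x).
Proof.
  split; [now intros x [hx _]|]. intros x [hx ha]. exists (x - a). split; [lra|].
  intros y hy h. apply Rabs_def2 in h. split; [exact hy|lra].
Qed.

Lemma ball_open a d : open_in_I (fun x => inI x /\ a - d < x /\ x < a + d).
Proof.
  destruct (inter_open _ _ (lt_open (a + d)) (gt_open (a - d))) as [h1 h2].
  split; [now intros x [hx _]|]. intros x [hx ha].
  destruct (h2 x) as [e [he h]]; [tauto|].
  exists e. split; [exact he|]. intros y hy hxy. specialize (h y hy hxy). tauto.
Qed.

Lemma inner_interval U x d :
  inI x -> d > 0 -> (forall y, inI y -> Rabs (y - x) < d -> U y) ->
  exists a b, 0 < a /\ a < b /\ b < 1 /\ forall y, a <= y <= b -> U y.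
Proof.
  (* The interval is placed on the side of [x] that faces 1/2; with [e <= 1 / 4] it stays away from
     0 and 1. *)
  intros hx hd h. set (e := Rmin (d / 2) (1 / 4)).
  assert (he : 0 < e /\ e <= d / 2 /\ e <= 1 / 4) by (unfold e; hull_lra).
  clearbody e. unfold inI in *. destruct (Rle_dec x (1 / 2)).
  - exists (x + e / 2), (x + e). repeat split; try lra.
    intros y hy. apply h; [lra|]. apply Rabs_def1; lra.
  - exists (x - e), (x - e / 2). repeat split; try lra.
    intros y hy. apply h; [lra|]. apply Rabs_def1; lra.
Qed.

Lemma open_inner_interval U :
  open_in_I U -> nonempty_in_I U ->
  exists a b, 0 < a /\ a < b /\ b < 1 /\ forall y, a <= y <= b -> U y.
Proof.
  intros [_ hU] [x [hx hu]]. destruct (hU x hu) as [d [hd h]].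
  now apply (inner_interval U x d).
Qed.

Lemma continuous_on_I_IVT g x y v :
  continuous_on_I g -> inI x -> inI y -> hull (g x) (g y) v ->
  exists z, hull x y z /\ g z = v.
Proof.
  intros hg.
  (* [clamp] retracts the line onto I, so that the global IVT applies. *)
  set (clamp := fun t : R => Rmax 0 (Rmin t 1)).
  assert (hcI : forall t, inI (clamp t)) by (intros; unfold clamp; hull_lra).
  assert (hcid : forall t, inI t -> clamp t = t)
    by (intros; unfold clamp; hull_lra).
  assert (hcl : forall s t, Rabs (clamp s - clamp t) <= Rabs (s - t)).
  { intros s t. unfold clamp, Rabs. repeat destruct Rcase_abs; hull_lra. }
  (* The sign [s] treats rising and falling crossings at once. *)
  assert (key : forall s a b w, (s = 1 \/ s = -1) -> inI a -> inI b -> a < b ->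
    s * (g a - w) < 0 -> 0 < s * (g b - w) -> exists z, a <= z <= b /\ g z = w).
  { intros s a b w hs ha hb hab h1 h2.
    set (h := fun t => s * (g (clamp t) - w)).
    assert (hcont : continuity h).
    { intros t e he. destruct (hg (clamp t) (hcI t) e he) as [d [hd hd']].
      exists d. split; [exact hd|]. intros u [_ hu].
      simpl in *. unfold Rdist in *. unfold h.
      replace (s * (g (clamp u) - w) - s * (g (clamp t) - w))
        with (s * (g (clamp u) - g (clamp t))) by ring.
      rewrite Rabs_mult.
      replace (Rabs s) with 1
        by (destruct hs; subst s; unfold Rabs; destruct Rcase_abs; lra).
      rewrite Rmult_1_l. apply hd'; [apply hcI|].
      eapply Rle_lt_trans; [apply hcl|exact hu]. }
    destruct (IVT h a b hcont hab) as [z [hz hz']].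
    - unfold h. now rewrite hcid.
    - unfold h. now rewrite hcid.
    - exists z. split; [exact hz|]. unfold h in hz'.
      rewrite hcid in hz' by (unfold inI in *; lra).
      destruct hs; subst s; lra. }
  intros hx hy hv.
  destruct (Req_dec (g x) v) as [e|nx]; [exists x; split; [hull_lra|exact e]|].
  destruct (Req_dec (g y) v) as [e|ny]; [exists y; split; [hull_lra|exact e]|].
  assert (hxy : x <> y) by (intros ->; hull_lra).
  assert (hs : (g x < v < g y) \/ (g y < v < g x)) by hull_lra.
  destruct (Rlt_dec x y) as [l|l]; destruct hs as [hs|hs].
  - destruct (key 1 x y v) as [z [hz e]]; try assumption; try tauto; try lra.
    exists z. split; [hull_lra|exact e].
  - destruct (key (-1) x y v) as [z [hz e]]; try assumption; try tauto; try lra.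
    exists z. split; [hull_lra|exact e].
  - destruct (key (-1) y x v) as [z [hz e]]; try assumption; try tauto; try lra.
    exists z. split; [hull_lra|exact e].
  - destruct (key 1 y x v) as [z [hz e]]; try assumption; try tauto; try lra.
    exists z. split; [hull_lra|exact e].
Qed.

Lemma iterf_IVT f n x y v :
  maps_I f -> continuous_on_I f -> inI x -> inI y ->
  hull (iterf f n x) (iterf f n y) v ->
  exists z, hull x y z /\ iterf f n z = v.
Proof.
  intros hm hc. apply continuous_on_I_IVT. now apply iterf_continuous.
Qed.

(** * Uniform constants for finitely many indices, and least elements *)

Lemma uniform_radius (P : nat -> R -> Prop) k :
  (forall i e e', 0 < e' <= e -> P i e -> P i e') ->
  (forall i, (i < k)%nat -> exists e, 0 < e /\ P i e) ->
  exists e, 0 < e /\ forall i, (i < k)%nat -> P i e.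
Proof.
  intros hP. induction k as [|k IH]; intros h.
  - exists 1. split; [lra|]. intros i hi. lia.
  - destruct IH as [e [he h1]]; [intros i hi; apply h; lia|].
    destruct (h k) as [e' [he' h2]]; [lia|].
    exists (Rmin e e'). split; [hull_lra|]. intros i hi.
    destruct (Nat.eq_dec i k) as [->|hne].
    + apply hP with e'; [hull_lra|exact h2].
    + apply hP with e; [hull_lra|]. apply h1. lia.
Qed.

Lemma uniform_threshold (P : nat -> nat -> Prop) k :
  (forall i N N', (N <= N')%nat -> P i N -> P i N') ->
  (forall i, (i < k)%nat -> exists N, P i N) ->
  exists N, forall i, (i < k)%nat -> P i N.
Proof.
  intros hP. induction k as [|k IH]; intros h.
  - exists 0%nat. intros i hi. lia.
  - destruct IH as [N h1]; [intros i hi; apply h; lia|].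
    destruct (h k) as [N' h2]; [lia|].
    exists (N + N')%nat. intros i hi. destruct (Nat.eq_dec i k) as [->|hne].
    + apply hP with N'; [lia|exact h2].
    + apply hP with N; [lia|]. apply h1. lia.
Qed.

Lemma exists_least (P : nat -> Prop) :
  (exists n, P n) -> exists n, P n /\ forall m, P m -> (n <= m)%nat.
Proof.
  intros [n hn]. revert hn. induction n as [n IH] using (well_founded_induction lt_wf).
  intros hn. destruct (classic (exists m, (m < n)%nat /\ P m)) as [[m [hm h]]|h].
  - now apply (IH m).
  - exists n. split; [exact hn|]. intros m hm.
    destruct (Nat.le_gt_cases n m); [assumption|]. exfalso. apply h. now exists m.
Qed.

(** * Strong mixing implies topological K *)

(** At every late time some point of [[a, b]] is sent below [eta] and another above [1 - eta]; the
    intermediate value theorem fills the range between. *)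
Lemma mixing_covers f a b eta :
  maps_I f -> continuous_on_I f -> strongly_mixing f ->
  0 <= a -> a < b -> b <= 1 -> 0 < eta < 1 ->
  exists N, forall n, (N <= n)%nat -> forall y, eta <= y <= 1 - eta ->
    exists x, a <= x <= b /\ iterf f n x = y.
Proof.
  intros hm hc hmix h0 hab h1 he.
  set (U := fun x => inI x /\ (a + b) / 2 - (b - a) / 2 < x /\ x < (a + b) / 2 + (b - a) / 2).
  assert (hU : nonempty_in_I U)
    by (exists ((a + b) / 2); unfold U, inI; repeat split; lra).
  destruct (hmix U _ (ball_open _ _) (lt_open eta) hU) as [N1 hN1].
  { exists 0. unfold inI. repeat split; lra. }
  destruct (hmix U _ (ball_open _ _) (gt_open (1 - eta)) hU) as [N2 hN2].
  { exists 1. unfold inI. repeat split; lra. }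
  exists (N1 + N2)%nat. intros n hn y hy.
  destruct (hN1 n) as [x1 [hx1 [[_ hu1] [_ hv1]]]]; [lia|].
  destruct (hN2 n) as [x2 [hx2 [[_ hu2] [_ hv2]]]]; [lia|].
  destruct (iterf_IVT f n x1 x2 y hm hc hx1 hx2) as [z [hz e]]; [hull_lra|].
  exists z. split; [hull_lra|exact e].
Qed.

(** Induction on the word length: realize the shifted word by [z], then pull [z] back into the first
    interval, which covers the second. *)
Lemma horseshoe_realizes f N k (a b : nat -> R) :
  (forall i j, (i < k)%nat -> (j < k)%nat -> forall y, a j <= y <= b j ->
    exists x, a i <= x <= b i /\ iterf f N x = y) ->
  (forall i, (i < k)%nat -> a i <= b i) ->
  forall m (s : nat -> nat), (forall j, (s j < k)%nat) ->
  exists x, forall j, (j <= m)%nat -> a (s j) <= iterf f (j * N) x <= b (s j).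
Proof.
  intros hcov hab m. induction m as [|m IH]; intros s hs.
  - exists (a (s 0%nat)). intros j hj. replace j with 0%nat by lia. simpl.
    specialize (hab _ (hs 0%nat)). lra.
  - destruct (IH (fun j => s (S j)) (fun j => hs (S j))) as [z hz].
    destruct (hcov (s 0%nat) (s 1%nat) (hs _) (hs _) z) as [x [hx e]].
    { apply (hz 0%nat). lia. }
    exists x. intros [|j] hj; [exact hx|].
    replace (S j * N)%nat with (j * N + N)%nat by lia.
    rewrite iterf_add, e. apply hz. lia.
Qed.

(** The right side is [n / N] rounded up, since 0 is itself counted. *)
Lemma count_below_multiples N n : (0 < N)%nat ->
  count_below (fun i => Nat.eqb (i mod N) 0) n = ((n + (N - 1)) / N)%nat.
Proof.
  intros hN. induction n as [|n IH].
  - simpl. symmetry. apply Nat.div_small. lia.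
  - simpl count_below. rewrite IH.
    pose proof (Nat.div_mod_eq n N) as hd.
    pose proof (Nat.mod_upper_bound n N ltac:(lia)) as hr.
    set (q := (n / N)%nat) in *. set (r := (n mod N)%nat) in *.
    clearbody q r. destruct (Nat.eqb_spec r 0) as [hr0|hr0].
    + rewrite <- (Nat.div_unique (n + (N - 1)) N q (N - 1)) by lia.
      rewrite <- (Nat.div_unique (S n + (N - 1)) N (S q) 0) by lia. lia.
    + rewrite <- (Nat.div_unique (n + (N - 1)) N (S q) (r - 1)) by lia.
      rewrite <- (Nat.div_unique (S n + (N - 1)) N (S q) r) by lia. lia.
Qed.

Lemma positive_density_multiples N : (0 < N)%nat ->
  positive_density (fun i => Nat.eqb (i mod N) 0).
Proof.
  intros hN. assert (hN' : 0 < INR N) by now apply lt_0_INR.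
  exists (/ INR N). split; [now apply Rinv_0_lt_compat|].
  intros e he. destruct (archimed_cor1 e he) as [n0 [hn0 hn0']].
  exists n0. intros n hn. unfold Rdist. rewrite count_below_multiples by assumption.
  set (q := ((S n + (N - 1)) / N)%nat).
  (* [N * q] exceeds [S n] by less than [N], so the frequency differs from [/ INR N] by at most
     [/ INR (S n)]. *)
  assert (hq : (S n <= N * q /\ N * q < S n + N)%nat).
  { unfold q. pose proof (Nat.div_mod_eq (S n + (N - 1)) N) as hd.
    pose proof (Nat.mod_upper_bound (S n + (N - 1)) N ltac:(lia)) as hr. lia. }
  destruct hq as [h1 h2]. apply le_INR in h1. apply lt_INR in h2.
  rewrite plus_INR, mult_INR in h2. rewrite mult_INR in h1.
  assert (hS : 0 < INR (S n)) by (apply lt_0_INR; lia).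
  assert (hlt : / INR (S n) < e).
  { eapply Rle_lt_trans; [|exact hn0]. apply Rinv_le_contravar.
    - now apply lt_0_INR.
    - apply le_INR. lia. }
  replace (INR q / INR (S n) - / INR N)
    with ((INR N * INR q - INR (S n)) * / INR N * / INR (S n)) by (field; lra).
  rewrite !Rabs_mult, (Rabs_right (/ INR (S n)))
    by (left; now apply Rinv_0_lt_compat).
  rewrite (Rabs_right (/ INR N)) by (left; now apply Rinv_0_lt_compat).
  rewrite Rabs_right by lra.
  assert (hle : (INR N * INR q - INR (S n)) * / INR N <= 1).
  { apply Rmult_le_reg_r with (INR N); [assumption|].
    rewrite Rmult_assoc, Rinv_l by lra. lra. }
  apply Rle_lt_trans with (1 * / INR (S n)); [|lra].
  apply Rmult_le_compat_r; [left; now apply Rinv_0_lt_compat|exact hle].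
Qed.

Lemma mixing_topological_K f :
  maps_I f -> continuous_on_I f -> strongly_mixing f -> topological_K f.
Proof.
  intros hm hc hmix k hk xs hlen hxs _. split; [exact hxs|]. intros Us hUs.
  destruct (uniform_radius
    (fun j e => e <= 1 / 2 /\
       forall y, inI y -> Rabs (y - nth j xs 0) < e -> Us j y) (length xs))
    as [e [he hUe]].
  { intros i e e' he [h0 h]. split; [lra|]. intros y hy hyx. apply h; [exact hy|lra]. }
  { intros i hi. destruct (hUs i hi) as [e [he h]]. exists (Rmin e (1 / 2)).
    split; [hull_lra|]. split; [hull_lra|]. intros y hy hyx. apply h; [exact hy|].
    hull_lra. }
  (* Moving the neighbourhoods inside (0,1) deals with tuples containing 0 or 1. *)
  set (a := fun j => if Rle_dec (nth j xs 0) (1 / 2)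
                     then nth j xs 0 + e / 4 else nth j xs 0 - e / 2).
  set (b := fun j => if Rle_dec (nth j xs 0) (1 / 2)
                     then nth j xs 0 + e / 2 else nth j xs 0 - e / 4).
  assert (hI : forall j, (j < length xs)%nat -> inI (nth j xs 0))
    by (intros j hj; apply hxs, nth_In, hj).
  assert (hab : forall j, (j < length xs)%nat ->
    e / 4 <= a j /\ a j < b j /\ b j <= 1 - e / 4 /\
    forall y, a j <= y <= b j -> Us j y).
  { intros j hj. destruct (hUe j hj) as [he2 h]. specialize (hI j hj).
    unfold inI in *. unfold a, b. destruct Rle_dec; repeat split; try lra;
    intros y hy; (apply h; [lra|]; apply Rabs_def1; lra). }
  clearbody a b.
  assert (he2 : e <= 1 / 2) by (apply (hUe 0%nat); lia).
  (* All [[a j, b j]] lie in [[e / 4, 1 - e / 4]], so beyond one threshold each of them covers all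
     of them. *)
  destruct (uniform_threshold (fun i N => forall n, (N <= n)%nat -> forall y,
    e / 4 <= y <= 1 - e / 4 -> exists x, a i <= x <= b i /\ iterf f n x = y)
    (length xs)) as [N hN].
  { intros i N N' hNN h n hn. apply h. lia. }
  { intros i hi. specialize (hab i hi). apply mixing_covers; try assumption; lra. }
  set (N' := S N).
  exists (fun i => Nat.eqb (i mod N') 0).
  split; [|apply positive_density_multiples; unfold N'; lia].
  intros F s hF hJ hs.
  (* Only the multiples of [N'] in [F] are prescribed; elsewhere the symbol defaults to 0, a legal
     index because [k >= 2]. *)
  set (sigma := fun j => if in_dec Nat.eq_dec (j * N')%nat F then s (j * N')%nat else 0%nat).
  destruct (horseshoe_realizes f N' (length xs) a b) with (m := list_max F) (s := sigma)
    as [x hx].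
  - intros i j hi hj y hy. apply (hN i hi); [unfold N'; lia|].
    specialize (hab j hj). lra.
  - intros i hi. specialize (hab i hi). lra.
  - intros j. unfold sigma. destruct in_dec as [hin|_]; [now apply hs|lia].
  - exists x.
    assert (hx0 : a (sigma 0%nat) <= x <= b (sigma 0%nat)) by (apply (hx 0%nat); lia).
    assert (hs0 : (sigma 0 < length xs)%nat).
    { unfold sigma. destruct in_dec as [hin|_]; [now apply hs|lia]. }
    split; [specialize (hab _ hs0); unfold inI; lra|].
    intros i hi. pose proof (hJ i hi) as hmod. apply Nat.eqb_eq in hmod.
    pose proof (Nat.div_mod_eq i N') as hd. rewrite hmod in hd.
    assert (hile : (i <= list_max F)%nat).
    { pose proof (proj1 (list_max_le F (list_max F)) (le_n _)) as hall.
      rewrite Forall_forall in hall. now apply hall. }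
    specialize (hx (i / N')%nat). unfold sigma in hx.
    replace (i / N' * N')%nat with i in hx by lia.
    destruct in_dec as [_|hn]; [|contradiction].
    apply hab; [now apply hs|]. apply hx. unfold N' in *. nia.
Qed.

Lemma topological_K_upe f : topological_K f -> uniformly_positive_entropy f.
Proof.
  intros h x1 x2 h1 h2 hne. apply (h 2%nat); [lia|reflexivity| |].
  - intros x [<-|[<-|[]]]; assumption.
  - constructor; [intros [->|[]]; now apply hne|].
    constructor; [intros []|constructor].
Qed.

(** * Itineraries and the cover condition *)

(** A Boolean sequence codes the letter at each time, [true] for [U]; this and the next lemma pass
    between words and members of the join. *)
Lemma join_iter_itinerary f U V n B :
  In B (join_iter f [U; V] n) ->
  exists t : nat -> bool, forall x, B x -> forall i, (i < n)%nat ->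
    (if t i then U else V) (iterf f i x).
Proof.
  revert B. induction n as [|n IH]; intros B hB.
  - exists (fun _ => true). intros x _ i hi. lia.
  - simpl in hB. apply in_flat_map in hB. destruct hB as [A [hA hB]].
    destruct (IH A hA) as [t ht].
    assert (hext : forall (b : bool) W, W = (if b then U else V) ->
      B = (fun x => A x /\ preimg f n W x) ->
      exists t : nat -> bool, forall x, B x -> forall i, (i < S n)%nat ->
        (if t i then U else V) (iterf f i x)).
    { intros b W hW ->. exists (fun i => if Nat.eq_dec i n then b else t i).
      intros x [hAx [_ hx]] i hi. destruct (Nat.eq_dec i n) as [->|hne].
      - now rewrite <- hW.
      - apply ht; [exact hAx|lia]. }
    destruct hB as [hB|[hB|[]]].
    + apply (hext true U); [reflexivity|now symmetry].
    + apply (hext false V); [reflexivity|now symmetry].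
Qed.

Lemma itinerary_join_iter f U V (t : nat -> bool) n :
  exists B, In B (join_iter f [U; V] n) /\
    forall x, inI x ->
      (forall i, (i < n)%nat -> (if t i then U else V) (iterf f i x)) -> B x.
Proof.
  induction n as [|n [A [hA h]]].
  - exists inI. split; [now left|]. now intros.
  - exists (fun x => A x /\ preimg f n (if t n then U else V) x). split.
    + simpl. apply in_flat_map. exists A. split; [exact hA|].
      destruct (t n); [now left|right; now left].
    + intros x hx hi. split; [apply h; [exact hx|]; intros i hin; apply hi; lia|].
      split; [exact hx|]. apply hi. lia.
Qed.

Lemma not_dense_gap U : ~ dense_in_I U ->
  exists x e, inI x /\ e > 0 /\ forall y, inI y -> Rabs (y - x) < e -> ~ U y.
Proof.
  intros h. apply NNPP. intros hn. apply h. intros x hx e he.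
  apply NNPP. intros h'. apply hn. exists x, e. split; [exact hx|].
  split; [exact he|]. intros y hy hyx hu. apply h'. now exists y.
Qed.

(** Otherwise the counts stay at most [M] and the ratios tend to 0, contradicting [d > 0]. *)
Lemma positive_density_unbounded J M :
  positive_density J -> exists n, (M <= n)%nat /\ J n = true.
Proof.
  intros [d [hd hcv]]. apply NNPP. intros hn.
  assert (hb : forall n, (count_below J n <= M)%nat).
  (* The minimum makes the induction work: below [M] each step adds at most one, from [M] on it adds
     none. *)
  { assert (hmin : forall n, (count_below J n <= Nat.min n M)%nat).
    { induction n as [|n IH]; [cbn; lia|]. cbn [count_below].
      destruct (J n) eqn:hJ; [|lia].
      destruct (Nat.le_gt_cases M n) as [hle|hle]; [|lia].
      exfalso. apply hn. now exists n. }
    intros n. specialize (hmin n). lia. }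
  destruct (hcv (d / 2)) as [n1 hn1]; [lra|].
  destruct (archimed_cor1 (d / 2 / (INR M + 1))) as [n2 [hn2 hn2']].
  { apply Rdiv_lt_0_compat; [lra|]. pose proof (pos_INR M). lra. }
  specialize (hn1 (n1 + n2)%nat ltac:(lia)).
  set (n := (n1 + n2)%nat) in *.
  assert (hS : 0 < INR (S n)) by (apply lt_0_INR; lia).
  assert (hM : 0 <= INR M) by apply pos_INR.
  assert (hc : INR (count_below J (S n)) <= INR M) by (apply le_INR, hb).
  assert (h2 : / INR (S n) < d / 2 / (INR M + 1)).
  { eapply Rle_lt_trans; [|exact hn2]. apply Rinv_le_contravar.
    - now apply lt_0_INR.
    - apply le_INR. unfold n. lia. }
  assert (h3 : (INR M + 1) * / INR (S n) < d / 2).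
  { apply Rmult_lt_compat_l with (r := INR M + 1) in h2; [|lra].
    eapply Rlt_le_trans; [exact h2|]. right. field. lra. }
  unfold Rdist in hn1. apply Rabs_def2 in hn1.
  assert (h4 : INR (count_below J (S n)) / INR (S n) <= (INR M + 1) * / INR (S n)).
  { apply Rmult_le_compat_r; [left; now apply Rinv_0_lt_compat|lra]. }
  lra.
Qed.

(* Two independent times give four points realizing different words; a member
   of the join contains at most one of them. Three of them suffice. *)
Lemma upe_cover_condition f :
  uniformly_positive_entropy f -> two_set_cover_condition f.
Proof.
  intros hupe U V _ _ hcov hU hV.
  destruct (not_dense_gap U hU) as [x1 [e1 [hx1 [he1 h1]]]].
  destruct (not_dense_gap V hV) as [x2 [e2 [hx2 [he2 h2]]]].
  assert (hne : x1 <> x2).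
  { intros <-. assert (hz : Rabs (x1 - x1) = 0) by (rewrite Rminus_diag; apply Rabs_R0).
    destruct (hcov x1 hx1) as [A [[<-|[<-|[]]] hA]].
    - apply (h1 x1); [exact hx1|lra|exact hA].
    - apply (h2 x1); [exact hx1|lra|exact hA]. }
  destruct (hupe x1 x2 hx1 hx2 hne) as [_ hIE].
  (* Independence is applied to the complements, which are neighbourhoods of the gap centres [x1]
     and [x2]. *)
  destruct (hIE (fun j x => if Nat.eqb j 0 then ~ U x else ~ V x)) as [J [hind hden]].
  { intros [|[|j]] hj; simpl in hj; [| |lia].
    - exists e1. split; [exact he1|]. exact h1.
    - exists e2. split; [exact he2|]. exact h2. }
  destruct (positive_density_unbounded J 0 hden) as [i1 [_ hi1]].
  destruct (positive_density_unbounded J (S i1) hden) as [i2 [hi hi2]].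
  assert (hpt : forall a b : bool, exists x, inI x /\
    ~ (if a then U else V) (iterf f i1 x) /\ ~ (if b then U else V) (iterf f i2 x)).
  { intros a b.
    destruct (hind [i1; i2]
      (fun i => if Nat.eqb i i1 then (if a then 0 else 1)%nat
                else (if b then 0 else 1)%nat)) as [x [hx h]].
    - discriminate.
    - intros i [<-|[<-|[]]]; assumption.
    - intros i _. cbn [length]. destruct (Nat.eqb i i1), a, b; lia.
    - exists x. split; [exact hx|].
      pose proof (h i1 (or_introl eq_refl)) as ha.
      pose proof (h i2 (or_intror (or_introl eq_refl))) as hb.
      rewrite Nat.eqb_refl in ha.
      replace (Nat.eqb i2 i1) with false in hb by (symmetry; apply Nat.eqb_neq; lia).
      destruct a, b; split; assumption. }
  (* Avoiding one set forces the other letter: at times [i1], [i2] these three points need the words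
     VV, VU and UU. *)
  destruct (hpt true true) as [x [hx [hx' hx'']]].
  destruct (hpt true false) as [y [hy [hy' hy'']]].
  destruct (hpt false false) as [z [hz [hz' hz'']]].
  exists (S i2). intros n hn k [[L [hL [hLc hlen]]] _].
  assert (hB : forall B, In B L ->
    ~ (B x /\ B y) /\ ~ (B x /\ B z) /\ ~ (B y /\ B z)).
  { intros B hB. destruct (join_iter_itinerary f U V n B (hL B hB)) as [t ht].
    repeat split; intros [hb hb'];
      pose proof (ht _ hb i1 ltac:(lia)); pose proof (ht _ hb' i1 ltac:(lia));
      pose proof (ht _ hb i2 ltac:(lia)); pose proof (ht _ hb' i2 ltac:(lia));
      destruct (t i1), (t i2); contradiction. }
  destruct (hLc x hx) as [A [hA hAx]].
  destruct (hLc y hy) as [B [hB1 hBy]].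
  destruct (hLc z hz) as [C [hC hCz]].
  destruct L as [|L1 [|L2 [|L3 L]]]; simpl in hlen; [| | |lia]; exfalso;
    simpl in hA, hB1, hC.
  - tauto.
  - destruct hA as [<-|[]], hB1 as [<-|[]].
    destruct (hB L1 (or_introl eq_refl)). tauto.
  - destruct (hB L1 (or_introl eq_refl)) as [a1 [a2 a3]].
    destruct (hB L2 (or_intror (or_introl eq_refl))) as [b1 [b2 b3]].
    destruct hA as [<-|[<-|[]]], hB1 as [<-|[<-|[]]], hC as [<-|[<-|[]]]; tauto.
Qed.

(* If no orbit met both [O_(t i)] at a time [i] and the other set at a time [j],
   the words avoiding the sets prescribed by [t] and by its negation would give
   two elements of the join covering I. *)
Lemma cover_condition_pattern f O1 O2 (t : nat -> bool) :
  maps_I f -> two_set_cover_condition f ->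
  open_in_I O1 -> open_in_I O2 -> nonempty_in_I O1 -> nonempty_in_I O2 ->
  (forall x, O1 x -> O2 x -> False) ->
  exists x i j, inI x /\ (if t i then O1 else O2) (iterf f i x) /\
    (if t j then O2 else O1) (iterf f j x).
Proof.
  intros hm hcc hO1 hO2 hne1 hne2 hdis. apply NNPP. intros hno.
  destruct (open_inner_interval O1 hO1 hne1) as [a1 [b1 [ha1 [hab1 [hb1 h1]]]]].
  destruct (open_inner_interval O2 hO2 hne2) as [a2 [b2 [ha2 [hab2 [hb2 h2]]]]].
  (* Complements of closed intervals inside [O1] and [O2] are open, not dense, and cover I because
     [O1] and [O2] are disjoint. *)
  set (W := fun a b x => inI x /\ (x < a \/ b < x)).
  assert (hWo : forall a b, open_in_I (W a b)).
  { intros a b. split; [now intros x [hx _]|]. intros x [hx [h|h]].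
    - destruct (lt_open a) as [_ ho]. destruct (ho x (conj hx h)) as [d [hd hd']].
      exists d. split; [exact hd|]. intros y hy hyx.
      destruct (hd' y hy hyx). unfold W. tauto.
    - destruct (gt_open b) as [_ ho]. destruct (ho x (conj hx h)) as [d [hd hd']].
      exists d. split; [exact hd|]. intros y hy hyx.
      destruct (hd' y hy hyx). unfold W. tauto. }
  assert (hWd : forall a b, 0 < a -> a < b -> b < 1 -> ~ dense_in_I (W a b)).
  { intros a b h0 hab hb1' hd.
    destruct (hd ((a + b) / 2)) with (eps := (b - a) / 2) as [y [_ [hy [_ hy']]]].
    - unfold inI; lra.
    - lra.
    - apply Rabs_def2 in hy. destruct hy'; lra. }
  assert (hW : forall a b x, inI x -> ~ W a b x -> a <= x <= b)
    by (intros a b x hx h; split; apply Rnot_lt_le; intros hl; apply h; unfold W; tauto).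
  destruct (hcc (W a1 b1) (W a2 b2)) as [n0 hn0]; try now auto.
  { intros x hx. destruct (classic (W a1 b1 x)) as [h|h].
    - exists (W a1 b1). split; [now left|exact h].
    - exists (W a2 b2). split; [right; now left|]. apply NNPP. intros h'.
      apply (hdis x); auto. }
  set (L := join_iter f [W a1 b1; W a2 b2] n0) in *.
  destruct (itinerary_join_iter f (W a1 b1) (W a2 b2) t n0) as [B [hB hB']].
  destruct (itinerary_join_iter f (W a1 b1) (W a2 b2) (fun i => negb (t i)) n0)
    as [C [hC hC']].
  assert (hcov : covers_I [B; C]).
  { intros x hx. apply NNPP. intros hnc.
    assert (hnB : ~ B x) by (intros hb; apply hnc; exists B; split; [now left|exact hb]).
    assert (hnC : ~ C x)
      by (intros hc; apply hnc; exists C; split; [right; now left|exact hc]).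
    apply hnB, hB'; [exact hx|]. intros i _. apply NNPP. intros hi.
    apply hnC, hC'; [exact hx|]. intros j _. apply NNPP. intros hj.
    apply hno. exists x, i, j. split; [exact hx|].
    pose proof (iterf_inI f i x hm hx) as hIi.
    pose proof (iterf_inI f j x hm hx) as hIj.
    split.
    - destruct (t i); [apply h1|apply h2]; now apply hW.
    - destruct (t j); simpl in hj; [apply h2|apply h1]; now apply hW. }
  (* [complexity_gt2] speaks of the minimal cardinality only, so its existence is first obtained by
     well-ordering. *)
  destruct (exists_least (fun k => exists S, incl S L /\ covers_I S /\ length S = k))
    as [k [hk hmin]].
  { exists 2%nat, [B; C]. split; [|split; [exact hcov|reflexivity]].
    intros A [<-|[<-|[]]]; assumption. }
  assert (hk2 : (2 < k)%nat).
  { apply (hn0 n0 (le_n _)). split; [exact hk|]. intros S hS hScov.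
    apply hmin. now exists S. }
  assert (hle : (k <= 2)%nat); [|lia].
  apply hmin. exists [B; C]. split; [|split; [exact hcov|reflexivity]].
  intros A [<-|[<-|[]]]; assumption.
Qed.

(** * Transitivity *)

(** Requiring [1 <= n] makes the case [U = V] a genuine return. *)
Definition transitive (f : R -> R) : Prop :=
  forall U V, open_in_I U -> open_in_I V -> nonempty_in_I U -> nonempty_in_I V ->
    exists n, (1 <= n)%nat /\ exists x, U x /\ V (iterf f n x).

(** Split [P] at the middle of an inner interval. The constant word gives an orbit that meets both
    halves, necessarily at two different times. *)
Lemma cover_condition_nonwandering f P :
  maps_I f -> two_set_cover_condition f -> open_in_I P -> nonempty_in_I P ->
  exists n, (1 <= n)%nat /\ exists x, P x /\ P (iterf f n x).
Proof.
  intros hm hcc hP hne.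
  destruct (open_inner_interval P hP hne) as [a [b [ha [hab [hb h]]]]].
  destruct (cover_condition_pattern f
    (fun x => P x /\ inI x /\ x < (a + b) / 2)
    (fun x => P x /\ inI x /\ (a + b) / 2 < x) (fun _ => true) hm hcc)
    as [x [i [j [hx [hi hj]]]]].
  - apply inter_open; [exact hP|apply lt_open].
  - apply inter_open; [exact hP|apply gt_open].
  - exists a. unfold inI. repeat split; try lra. apply h. lra.
  - exists b. unfold inI. repeat split; try lra. apply h. lra.
  - intros x [_ h1] [_ h2]. lra.
  - simpl in hi, hj. destruct (Nat.lt_trichotomy i j) as [hij|[<-|hij]].
    + exists (j - i)%nat. split; [lia|]. exists (iterf f i x).
      rewrite <- iterf_add. replace (j - i + i)%nat with j by lia. tauto.
    + exfalso. lra.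
    + exists (i - j)%nat. split; [lia|]. exists (iterf f j x).
      rewrite <- iterf_add. replace (i - j + j)%nat with i by lia. tauto.
Qed.

(* If no orbit goes from [O1] to [O2], take the least [r] with
   [f^r O2] meeting [O1]: the points of [O2] entering [O1] at time [r] never
   return to [O2] and so form a wandering open set. *)
Lemma cover_condition_transitive f :
  maps_I f -> continuous_on_I f -> two_set_cover_condition f -> transitive f.
Proof.
  intros hm hc hcc O1 O2 hO1 hO2 hne1 hne2. apply NNPP. intros hno.
  assert (hno' : forall n x, (1 <= n)%nat -> O1 x -> ~ O2 (iterf f n x))
    by (intros n x hn h1 h2; apply hno; exists n; split; [exact hn|now exists x]).
  (* A common open part would return to itself and so give an orbit from [O1] to [O2]. *)
  assert (hdis : forall x, O1 x -> O2 x -> False).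
  { intros x h1 h2.
    destruct (cover_condition_nonwandering f (fun x => O1 x /\ O2 x) hm hcc)
      as [n [hn [y [[hy _] [_ hy']]]]].
    - now apply inter_open.
    - exists x. split; [now apply (proj1 hO1)|now split].
    - now apply (hno' n y). }
  destruct (exists_least (fun r => exists y, O2 y /\ O1 (iterf f r y)))
    as [r [[y [hy hry]] hmin]].
  { destruct (cover_condition_pattern f O1 O2 (fun _ => true) hm hcc)
      as [x [i [j [hx [hi hj]]]]]; try assumption.
    simpl in hi, hj. destruct (Nat.le_gt_cases j i) as [hij|hij].
    - exists (i - j)%nat, (iterf f j x). split; [exact hj|].
      rewrite <- iterf_add. now replace (i - j + j)%nat with i by lia.
    - exfalso. apply (hno' (j - i)%nat (iterf f i x)); [lia|exact hi|].
      rewrite <- iterf_add. now replace (j - i + i)%nat with j by lia. }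
  destruct (cover_condition_nonwandering f (fun z => O2 z /\ preimg f r O1 z) hm hcc)
    as [n [hn [z [[hz [hzI hrz]] [hnz _]]]]].
  - apply inter_open; [exact hO2|]. now apply preimg_open.
  - exists y. pose proof (proj1 hO2 y hy). split; [assumption|].
    split; [exact hy|now split].
  (* A return with [n < r] contradicts minimality, [n = r] disjointness, and [n > r] leads from [O1]
     to [O2]. *)
  - destruct (Nat.lt_trichotomy n r) as [hnr|[->|hnr]].
    + specialize (hmin (r - n)%nat). enough (r <= r - n)%nat by lia.
      apply hmin. exists (iterf f n z). split; [exact hnz|].
      rewrite <- iterf_add. now replace (r - n + n)%nat with r by lia.
    + now apply (hdis (iterf f r z)).
    + apply (hno' (n - r)%nat (iterf f r z)); [lia|exact hrz|].
      rewrite <- iterf_add. now replace (n - r + r)%nat with n by lia.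
Qed.

(** Replacing [V] by its preimage gains one step; the preimage is nonempty, since an orbit hitting
    [V] at a positive time is in it one step earlier. *)
Lemma transitive_late f N U V :
  maps_I f -> continuous_on_I f -> transitive f ->
  open_in_I U -> open_in_I V -> nonempty_in_I U -> nonempty_in_I V ->
  exists n, (N <= n)%nat /\ exists x, U x /\ V (iterf f n x).
Proof.
  intros hm hc ht hU hV hneU hneV. revert V hV hneV.
  induction N as [|N IH]; intros V hV hneV.
  - destruct (ht U V hU hV hneU hneV) as [n [_ h]]. exists n. split; [lia|exact h].
  - destruct (IH (preimg f 1 V)) as [n [hn [x [hx [_ h]]]]].
    + now apply preimg_open.
    + destruct (ht U V hU hV hneU hneV) as [n [hn [x [hx h]]]].
      exists (iterf f (n - 1) x). pose proof (proj1 hU x hx) as hxI.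
      pose proof (iterf_inI f (n - 1) x hm hxI) as hI. split; [exact hI|].
      split; [exact hI|]. rewrite <- iterf_add.
      now replace (1 + (n - 1))%nat with n by lia.
    + exists (S n). split; [lia|]. exists x. split; [exact hx|exact h].
Qed.

Lemma transitive_interval f a b V :
  transitive f -> 0 <= a -> a < b -> b <= 1 -> open_in_I V -> nonempty_in_I V ->
  exists n x, a < x < b /\ V (iterf f n x).
Proof.
  intros ht h0 hab h1 hV hneV.
  destruct (ht _ V (ball_open ((a + b) / 2) ((b - a) / 2)) hV) as [n [_ [x [hx h]]]].
  - exists ((a + b) / 2). unfold inI. repeat split; lra.
  - exact hneV.
  - exists n, x. split; [lra|exact h].
Qed.

Lemma transitive_no_invariant_interval f a b v w :
  transitive f -> 0 <= a -> a < b -> b <= 1 -> 0 <= v -> v < w -> w <= 1 ->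
  w <= a \/ b <= v ->
  (forall x, a <= x <= b -> a <= f x <= b) -> False.
Proof.
  intros ht h0 hab h1 h0' hvw h1' hd hinv.
  destruct (transitive_interval f a b _ ht h0 hab h1
    (ball_open ((v + w) / 2) ((w - v) / 2))) as [n [x [hx hn]]].
  - exists ((v + w) / 2). unfold inI. repeat split; lra.
  - enough (h : a <= iterf f n x <= b) by lra.
    clear hn. induction n as [|n IH]; [simpl; lra|]. now apply hinv.
Qed.

(** If the graph stayed strictly above the diagonal on (0,1), [[1/2, 1]] would be invariant; if
    strictly below, [[0, 1/2]]. So [f x - x] has a zero between two inner points. *)
Lemma transitive_inner_fixed_point f :
  maps_I f -> continuous_on_I f -> transitive f ->
  exists c, 0 < c < 1 /\ f c = c.
Proof.
  intros hm hc ht.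
  assert (ha : exists a, 0 < a < 1 /\ f a <= a).
  { apply NNPP. intros hn.
    assert (h : forall x, 0 < x < 1 -> x < f x)
      by (intros x hx; apply Rnot_le_lt; intros hle; apply hn; now exists x).
    apply (transitive_no_invariant_interval f (1 / 2) 1 0 (1 / 2) ht); try lra.
    intros x hx. assert (hxI : inI x) by (unfold inI; lra).
    pose proof (hm x hxI) as hfx. unfold inI in hfx. split; [|lra].
    destruct (Req_dec x 1) as [->|hx1]; [|specialize (h x); lra].
    apply Rnot_lt_le. intros hlt.
    (* If [f 1 < 1 / 2], continuity gives some [y] near 1 with [f y < 1 / 2 < y]. *)
    destruct (hc 1 hxI (1 / 2 - f 1)) as [d [hd hd']]; [lra|].
    set (y := 1 - Rmin (d / 2) (1 / 4)).
    assert (hy : 1 - d < y < 1 /\ 3 / 4 <= y) by (unfold y; hull_lra).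
    clearbody y. specialize (hd' y). rewrite Rabs_left in hd' by lra.
    assert (hk : Rabs (f y - f 1) < 1 / 2 - f 1) by (apply hd'; unfold inI; lra).
    apply Rabs_def2 in hk. specialize (h y). lra. }
  assert (hb : exists b, 0 < b < 1 /\ b <= f b).
  { apply NNPP. intros hn.
    assert (h : forall x, 0 < x < 1 -> f x < x)
      by (intros x hx; apply Rnot_le_lt; intros hle; apply hn; now exists x).
    apply (transitive_no_invariant_interval f 0 (1 / 2) (1 / 2) 1 ht); try lra.
    intros x hx. assert (hxI : inI x) by (unfold inI; lra).
    pose proof (hm x hxI) as hfx. unfold inI in hfx. split; [lra|].
    destruct (Req_dec x 0) as [->|hx1]; [|specialize (h x); lra].
    apply Rnot_lt_le. intros hlt.
    destruct (hc 0 hxI (f 0 - 1 / 2)) as [d [hd hd']]; [lra|].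
    set (y := Rmin (d / 2) (1 / 4)).
    assert (hy : 0 < y < d /\ y <= 1 / 4) by (unfold y; hull_lra).
    clearbody y. specialize (hd' y). rewrite Rabs_right in hd' by lra.
    assert (hk : Rabs (f y - f 0) < f 0 - 1 / 2) by (apply hd'; unfold inI; lra).
    apply Rabs_def2 in hk. specialize (h y). lra. }
  destruct ha as [a [ha ha']]. destruct hb as [b [hb hb']].
  destruct (continuous_on_I_IVT (fun x => f x - x) a b 0) as [c [hc1 hc2]].
  - intros x hx e he. destruct (hc x hx (e / 2)) as [d [hd h]]; [lra|].
    exists (Rmin d (e / 2)). split; [hull_lra|]. intros y hy hyx.
    assert (h1 : Rabs (f y - f x) < e / 2) by (apply h; [exact hy|hull_lra]).
    assert (h2 : Rabs (y - x) < e / 2) by hull_lra.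
    apply Rabs_def2 in h1. apply Rabs_def2 in h2. apply Rabs_def1; lra.
  - unfold inI; lra.
  - unfold inI; lra.
  - hull_lra.
  - exists c. split; [hull_lra|lra].
Qed.

(** * Covering relations between intervals ending at a fixed point *)

(** All intervals end at [c], which will be fixed by [f]: then a single image point beyond [v] gives
    the covering by intermediate values. *)
Definition covers_hull (f : R -> R) (c : R) (n : nat) (u v : R) : Prop :=
  forall y, hull v c y -> exists x, hull u c x /\ iterf f n x = y.

Lemma covers_hull_trans f c n m u v w :
  covers_hull f c n u v -> covers_hull f c m v w -> covers_hull f c (m + n) u w.
Proof.
  intros h1 h2 z hz. destruct (h2 z hz) as [y [hy <-]].
  destruct (h1 y hy) as [x [hx <-]]. exists x. split; [exact hx|apply iterf_add].
Qed.

Lemma covers_hull_mul f c n k p :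
  covers_hull f c n p p -> covers_hull f c (k * n) p p.
Proof.
  intros h. induction k as [|k IH].
  - intros y hy. now exists y.
  - simpl. now apply covers_hull_trans with p.
Qed.

(** Transitivity sends a point between [u] and [c] into the part of I beyond [v] as seen from [c],
    nonempty because [v] is inner. *)
Lemma covers_hull_reach f c u v :
  maps_I f -> continuous_on_I f -> transitive f -> f c = c -> 0 < c < 1 ->
  inI u -> u <> c -> 0 < v < 1 -> exists n, covers_hull f c n u v.
Proof.
  intros hm hc ht hfc hc01 hu huc hv.
  assert (hhit : exists n x, hull u c x /\ hull (iterf f n x) c v).
  { destruct (Rle_dec v c) as [hvc|hvc].
    - destruct (transitive_interval f (Rmin u c) (Rmax u c)
        (fun x => inI x /\ x < v) ht) as [n [x [hx [_ h]]]];
        try apply lt_open; try hull_lra.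
      + exists 0. unfold inI. repeat split; lra.
      + exists n, x. split; hull_lra.
    - destruct (transitive_interval f (Rmin u c) (Rmax u c)
        (fun x => inI x /\ v < x) ht) as [n [x [hx [_ h]]]];
        try apply gt_open; try hull_lra.
      + exists 1. unfold inI. repeat split; lra.
      + exists n, x. split; hull_lra. }
  destruct hhit as [n [x [hx h]]]. exists n. intros y hy.
  destruct (iterf_IVT f n x c y hm hc) as [z [hz e]].
  - hull_lra.
  - hull_lra.
  - rewrite (iterf_fixed f n c hfc). hull_lra.
  - exists z. split; [hull_lra|exact e].
Qed.

(** If every point changed sides, the parity of the time would fix the side of its orbit, against
    the alternating word in [cover_condition_pattern]. *)
Lemma cover_condition_same_side f c :
  maps_I f -> continuous_on_I f -> two_set_cover_condition f ->
  f c = c -> 0 < c < 1 ->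
  exists p, 0 < p < 1 /\ (p < c /\ f p < c \/ c < p /\ c < f p).
Proof.
  intros hm hc hcc hfc hc01. apply NNPP. intros hno.
  (* Continuity moves a same-side point at 0 or 1 into the interior, so the assumption extends to
     all of I. *)
  assert (hno' : forall p, inI p -> ~ (p < c /\ f p < c \/ c < p /\ c < f p)).
  { intros p hp hside. pose proof (hm p hp) as hfp.
    destruct (hc p hp (Rabs (f p - c))) as [d [hd h]].
    { apply Rabs_pos_lt. lra. }
    set (e := Rmin (d / 2) (Rmin (c / 2) ((1 - c) / 2))).
    assert (he : 0 < e /\ e < d /\ e < c /\ e < 1 - c) by (unfold e; hull_lra).
    clearbody e. apply hno. unfold inI in *.
    destruct hside as [[h1 h2]|[h1 h2]].
    - exists (Rmax p (Rmin e ((p + c) / 2))).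
      set (q := Rmax p (Rmin e ((p + c) / 2))).
      assert (hq : 0 < q < c /\ p <= q < p + d) by (unfold q; hull_lra).
      clearbody q. split; [lra|]. left. split; [lra|].
      assert (hk : Rabs (f q - f p) < Rabs (f p - c)).
      { apply h; [lra|]. apply Rabs_def1; lra. }
      rewrite (Rabs_left (f p - c)) in hk by lra. apply Rabs_def2 in hk. lra.
    - exists (Rmin p (Rmax (1 - e) ((p + c) / 2))).
      set (q := Rmin p (Rmax (1 - e) ((p + c) / 2))).
      assert (hq : c < q < 1 /\ p - d < q <= p) by (unfold q; hull_lra).
      clearbody q. split; [lra|]. right. split; [lra|].
      assert (hk : Rabs (f q - f p) < Rabs (f p - c)).
      { apply h; [lra|]. apply Rabs_def1; lra. }
      rewrite (Rabs_right (f p - c)) in hk by lra. apply Rabs_def2 in hk. lra. }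
  assert (hswap : forall x n, inI x ->
    (x <= c -> if Nat.even n then iterf f n x <= c else c <= iterf f n x) /\
    (c <= x -> if Nat.even n then c <= iterf f n x else iterf f n x <= c)).
  { intros x n hx. induction n as [|n [IH1 IH2]].
    - simpl. split; intros; lra.
    - rewrite Nat.even_succ, <- Nat.negb_even.
      change (iterf f (S n) x) with (f (iterf f n x)).
      pose proof (hno' _ (iterf_inI f n x hm hx)) as hn.
      destruct (Req_dec (iterf f n x) c) as [e|ne].
      + rewrite e, hfc. destruct (Nat.even n); simpl; split; intros; lra.
      + destruct (Nat.even n); simpl; split; intros hxc;
          [specialize (IH1 hxc)|specialize (IH2 hxc)
          |specialize (IH1 hxc)|specialize (IH2 hxc)];
          apply Rnot_lt_le; intros hlt; apply hn; lra. }
  destruct (cover_condition_pattern f _ _ Nat.even hm hcc (lt_open c) (gt_open c))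
    as [x [i [j [hx [hi hj]]]]].
  - exists 0. unfold inI. repeat split; lra.
  - exists 1. unfold inI. repeat split; lra.
  - intros x [_ h1] [_ h2]. lra.
  - destruct (Rle_dec x c) as [hxc|hxc].
    + pose proof (proj1 (hswap x j hx) hxc). destruct (Nat.even j); lra.
    + pose proof (proj2 (hswap x i hx)). destruct (Nat.even i); lra.
Qed.

(* The hull of [c] and [p] covers itself after [e] and after [e + 1] steps, and
   every [n >= e * e] is a sum of such lengths. *)
Lemma covers_hull_self f c p :
  maps_I f -> continuous_on_I f -> transitive f -> f c = c -> 0 < c < 1 ->
  0 < p < 1 -> (p < c /\ f p < c \/ c < p /\ c < f p) ->
  exists N, forall n, (N <= n)%nat -> covers_hull f c n p p.
Proof.
  intros hm hc ht hfc hc01 hp hside.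
  assert (hpI : inI p) by (unfold inI; lra). pose proof (hm p hpI) as hfp.
  (* [q] is whichever of [p] and [f p] is closer to [c]. *)
  assert (hq : exists q, inI q /\ q <> c /\ hull p c q /\ hull (f p) c q).
  { destruct (Rle_dec p (f p)), hside;
      first [exists p; split; [exact hpI|split; [lra|split; hull_lra]]
            |exists (f p); split; [exact hfp|split; [lra|split; hull_lra]]]. }
  destruct hq as [q [hqI [hqc [hq1 hq2]]]].
  destruct (covers_hull_reach f c q p) as [e he]; try assumption.
  assert (he0 : covers_hull f c e p p).
  { intros y hy. destruct (he y hy) as [x [hx ex]]. exists x.
    split; [hull_lra|exact ex]. }
  assert (he1 : covers_hull f c (e + 1) p p).
  { apply covers_hull_trans with q; [|exact he]. intros y hy.
    apply (iterf_IVT f 1 p c y hm hc hpI); [unfold inI; lra|].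
    rewrite (iterf_fixed f 1 c hfc). change (iterf f 1 p) with (f p). hull_lra. }
  exists (e * e)%nat. intros n hn.
  assert (hab : exists a b, n = (a * e + b * (e + 1))%nat).
  { destruct (Nat.eq_dec e 0) as [->|hne]; [exists 0%nat, n; lia|].
    pose proof (Nat.div_mod_eq n e) as hd.
    pose proof (Nat.mod_upper_bound n e hne) as hr.
    set (a := (n / e)%nat) in *. set (r := (n mod e)%nat) in *.
    (* With [n = a * e + r], lengthen [r] of the [a] blocks by one; this is possible as
       [r < e <= a]. *)
    assert (hra : (r <= a)%nat) by nia.
    exists (a - r)%nat, r. nia. }
  destruct hab as [a [b ->]].
  apply covers_hull_trans with p; now apply covers_hull_mul.
Qed.

(* [M i] collects the images of J at the times congruent to [i] modulo a return
   time [m] of J. Each [M i] is convex, and would avoid [c]; but some [M i] reaches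
   [c] arbitrarily closely, hence is mapped by some iterate to both sides of [c]. *)
Lemma preimages_of_fixed_point_dense f c p J :
  maps_I f -> continuous_on_I f -> transitive f -> f c = c -> 0 < c < 1 ->
  0 < p < 1 -> p <> c ->
  (exists N, forall n, (N <= n)%nat -> covers_hull f c n p p) ->
  open_in_I J -> nonempty_in_I J ->
  exists n x, J x /\ iterf f n x = c.
Proof.
  intros hm hc ht hfc hc01 hp hpc [N hN] hJ hneJ.
  destruct (open_inner_interval J hJ hneJ) as [a [b [ha [hab [hb hJab]]]]].
  apply NNPP. intros hno.
  set (K := fun x => inI x /\ (a + b) / 2 - (b - a) / 2 < x /\ x < (a + b) / 2 + (b - a) / 2).
  assert (hK : open_in_I K) by apply ball_open.
  assert (hneK : nonempty_in_I K)
    by (exists ((a + b) / 2); unfold K, inI; repeat split; lra).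
  assert (hno' : forall n x, K x -> iterf f n x <> c).
  { intros n x [_ hx] h. apply hno. exists n, x. split; [apply hJab; lra|exact h]. }
  assert (hconv : forall x y z, K x -> K y -> hull x y z -> K z)
    by (unfold K; intros x y z hx hy hz; hull_lra).
  destruct (ht K K hK hK hneK hneK) as [m [hm1 [x0 [hx0 hx0m]]]].
  set (M := fun i y => exists n x, K x /\ iterf f (n * m + i) x = y).
  assert (hMc : forall i, ~ M i c) by (intros i [n [x [hx h]]]; now apply (hno' (n * m + i)%nat x hx)).
  (* Consecutive images chain together: both contain [iterf f (S n * m + i) x0], because [x0] and
     [iterf f m x0] lie in [K]. *)
  assert (hbase : forall i n x z, K x ->
    hull (iterf f i x0) (iterf f (n * m + i) x) z -> M i z).
  { intros i n. induction n as [|n IH]; intros x z hx hz.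
    - destruct (iterf_IVT f i x0 x z hm hc (proj1 hx0) (proj1 hx) hz) as [w [hw e]].
      exists 0%nat, w. split; [now apply (hconv x0 x)|exact e].
    - set (v := iterf f (S n * m + i) x0).
      assert (hv : v = iterf f (n * m + i) (iterf f m x0)).
      { unfold v. rewrite <- iterf_add. f_equal. lia. }
      assert (hor : hull (iterf f i x0) v z \/ hull v (iterf f (S n * m + i) x) z).
      { unfold hull, Rmin, Rmax in *. repeat destruct Rle_dec; lra. }
      destruct hor as [hor|hor].
      + rewrite hv in hor. now apply (IH (iterf f m x0)).
      + destruct (iterf_IVT f (S n * m + i) x0 x z hm hc (proj1 hx0) (proj1 hx) hor)
          as [w [hw e]].
        exists (S n), w. split; [now apply (hconv x0 x)|exact e]. }
  assert (hMconv : forall i y w z, M i y -> M i w -> hull y w z -> M i z).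
  { intros i y w z [n1 [x1 [hx1 e1]]] [n2 [x2 [hx2 e2]]] hz.
    assert (hor : hull (iterf f i x0) y z \/ hull (iterf f i x0) w z).
    { unfold hull, Rmin, Rmax in *. repeat destruct Rle_dec; lra. }
    destruct hor as [hor|hor].
    - apply (hbase i n1 x1 z hx1). now rewrite e1.
    - apply (hbase i n2 x2 z hx2). now rewrite e2. }
  assert (hMI : forall i y, M i y -> inI y).
  { intros i y [n [x [hx <-]]]. apply iterf_inI; [exact hm|apply (proj1 hx)]. }
  assert (hMf : forall i k y, M i y -> M (k + i)%nat (iterf f k y)).
  { intros i k y [n [x [hx <-]]]. exists n, x. split; [exact hx|].
    rewrite <- iterf_add. f_equal. lia. }
  (* Otherwise the [m] residue classes would keep a common positive distance from [c], while
     transitivity sends [K] into every ball about [c]. *)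
  assert (hacc : exists i, forall e, 0 < e -> exists y, M i y /\ Rabs (y - c) < e).
  { apply NNPP. intros hn.
    destruct (uniform_radius (fun i e => forall y, M i y -> ~ Rabs (y - c) < e) m)
      as [e [he h]].
    - intros i e e' hle hi y hy hlt. apply (hi y hy). lra.
    - intros i _. apply NNPP. intros hi. apply hn. exists i. intros e he.
      apply NNPP. intros hy. apply hi. exists e. split; [exact he|].
      intros y hM hlt. apply hy. now exists y.
    - destruct (ht K _ hK (ball_open c e) hneK) as [n [_ [x [hx [_ hnx]]]]].
      { exists c. unfold inI. repeat split; lra. }
      apply (h (n mod m)%nat) with (y := iterf f n x).
      + apply Nat.mod_upper_bound. lia.
      + exists (n / m)%nat, x. split; [exact hx|]. f_equal.
        rewrite Nat.mul_comm. symmetry. apply Nat.div_mod_eq.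
      + apply Rabs_def1; lra. }
  destruct hacc as [i hacc]. destruct (hacc 1 Rlt_0_1) as [u [hu _]].
  assert (huc : u <> c) by (intros ->; now apply (hMc i)).
  assert (hMu : forall z, hull u c z -> z <> c -> M i z).
  { intros z hz hzc. destruct (hacc (Rabs (z - c))) as [w [hw hwz]].
    - apply Rabs_pos_lt. lra.
    - apply (hMconv i u w); try assumption. apply Rabs_def2 in hwz.
      assert (hwc : w <> c) by (intros ->; now apply (hMc i)).
      unfold Rabs in hwz. destruct Rcase_abs; hull_lra. }
  destruct (covers_hull_reach f c u p) as [n1 h1]; try assumption.
  { now apply (hMI i). }
  assert (hpI : inI p) by (unfold inI; lra).
  destruct (covers_hull_reach f c p (c / 2)) as [n2 h2]; try assumption; [lra|].
  destruct (covers_hull_reach f c p ((1 + c) / 2)) as [n3 h3]; try assumption; [lra|].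
  (* Any waiting time from [N] on is available on the hull of [p] and [c], so both routes can take
     the same total time [T]. *)
  set (T := (n2 + ((N + n3) + n1))%nat).
  assert (hl : covers_hull f c T u (c / 2)).
  { apply covers_hull_trans with p; [|exact h2].
    apply covers_hull_trans with p; [exact h1|]. apply hN. lia. }
  assert (hr : covers_hull f c T u ((1 + c) / 2)).
  { unfold T. replace (n2 + (N + n3 + n1))%nat with (n3 + ((N + n2) + n1))%nat by lia.
    apply covers_hull_trans with p; [|exact h3].
    apply covers_hull_trans with p; [exact h1|]. apply hN. lia. }
  destruct (hl (c / 2)) as [z1 [hz1 e1]]; [hull_lra|].
  destruct (hr ((1 + c) / 2)) as [z2 [hz2 e2]]; [hull_lra|].
  assert (hz1c : z1 <> c) by (intros ->; rewrite iterf_fixed in e1 by exact hfc; lra).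
  assert (hz2c : z2 <> c) by (intros ->; rewrite iterf_fixed in e2 by exact hfc; lra).
  apply (hMc (T + i)%nat), (hMconv _ (iterf f T z1) (iterf f T z2)).
  - now apply hMf, hMu.
  - now apply hMf, hMu.
  - rewrite e1, e2. hull_lra.
Qed.

(** * From the cover condition to strong mixing *)

Lemma cover_condition_strongly_mixing f :
  maps_I f -> continuous_on_I f -> two_set_cover_condition f -> strongly_mixing f.
Proof.
  intros hm hc hcc.
  pose proof (cover_condition_transitive f hm hc hcc) as ht.
  destruct (transitive_inner_fixed_point f hm hc ht) as [c [hc01 hfc]].
  destruct (cover_condition_same_side f c hm hc hcc hfc hc01) as [p [hp hside]].
  destruct (covers_hull_self f c p hm hc ht hfc hc01 hp hside) as [N hN].
  assert (hpc : p <> c) by lra.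
  intros U V hU hV hneU hneV.
  destruct (open_inner_interval U hU hneU) as [a [b [ha [hab [hb hUab]]]]].
  destruct (open_inner_interval V hV hneV) as [v [v' [hv [hvv [hv' hVv]]]]].
  set (J := fun x => inI x /\ (a + b) / 2 - (b - a) / 2 < x /\ x < (a + b) / 2 + (b - a) / 2).
  assert (hJ : open_in_I J) by apply ball_open.
  assert (hneJ : nonempty_in_I J)
    by (exists ((a + b) / 2); unfold J, inI; repeat split; lra).
  destruct (preimages_of_fixed_point_dense f c p J) as [n0 [x [hx hxc]]];
    try assumption; [now exists N|].
  (* If all of [J] were at [c] at time [n0], it would stay there, yet transitivity sends points of
     [J] below [c] at late times. *)
  assert (hy : exists y, J y /\ iterf f n0 y <> c).
  { destruct (transitive_late f n0 J _ hm hc ht hJ (lt_open c) hneJ)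
      as [n [hn [y [hy [_ hyc]]]]].
    - exists 0. unfold inI. repeat split; lra.
    - exists y. split; [exact hy|]. intros e.
      replace n with ((n - n0) + n0)%nat in hyc by lia.
      rewrite iterf_add, e, iterf_fixed in hyc by exact hfc. lra. }
  destruct hy as [y [hy hyc]].
  destruct (covers_hull_reach f c (iterf f n0 y) p) as [n1 h1]; try assumption.
  { apply iterf_inI; [exact hm|apply (proj1 hy)]. }
  destruct (covers_hull_reach f c p v) as [n2 h2]; try assumption; try lra.
  { unfold inI; lra. }
  exists (n2 + (N + (n1 + n0)))%nat. intros n hn.
  (* The waiting time [k] on the hull of [p] and [c] absorbs the excess of [n] and is at least
     [N]. *)
  set (k := (n - (n2 + (n1 + n0)))%nat).
  assert (h : covers_hull f c (n2 + (k + n1)) (iterf f n0 y) v).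
  { apply covers_hull_trans with p; [|exact h2].
    apply covers_hull_trans with p; [exact h1|]. apply hN. unfold k. lia. }
  destruct (h v) as [w [hw ew]]; [hull_lra|]. rewrite <- hxc in hw.
  destruct (iterf_IVT f n0 y x w hm hc (proj1 hy) (proj1 hx) hw) as [z [hz ez]].
  assert (hzab : a <= z <= b) by (unfold J in hx, hy; hull_lra).
  exists z. split; [unfold inI; lra|]. split; [now apply hUab|].
  replace n with ((n2 + (k + n1)) + n0)%nat by (unfold k; lia).
  rewrite iterf_add, ez, ew. apply hVv. lra.
Qed.

Theorem mainTheorem18 (f : R -> R) (hmap : maps_I f) (hcont : continuous_on_I f) :
  (strongly_mixing f <-> two_set_cover_condition f) /\
  (two_set_cover_condition f <-> uniformly_positive_entropy f) /\
  (uniformly_positive_entropy f <-> topological_K f).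
Proof.
  pose proof (mixing_topological_K f hmap hcont).
  pose proof (topological_K_upe f).
  pose proof (upe_cover_condition f).
  pose proof (cover_condition_strongly_mixing f hmap hcont).
  tauto.
Qed.
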